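(* A non-archimedean Polish group $G$ is amenable if and only if every continuous action of $G$ on the Cantor space $D^{\aleph_0}=\{0,1\}^{\mathbb N}$ admits an invariant Borel probability measure.
   Context: A Polish group is a separable completely metrizable topological group; it is non-archimedean if it is Hausdorff and has a neighbourhood base at the identity consisting of open subgroups. A topological group $G$ is amenable if every continuous action of $G$ on a compact Hausdorff space admits a $G$-invariant regular Borel probability measure. *)

(* Defs.v *)
From HB Require Import structures.
From mathcomp Require Import all_boot all_order all_algebra.
From mathcomp Require Import all_classical all_reals all_analysis.
Set Implicit Arguments. Unset Strict Implicit. Unset Printing Implicit Defensive.
Import Order.TTheory GRing.Theory Num.Theory.
Local Open Scope classical_set_scope.
Local Open Scope ring_scope.

Definition topological_group (G : topologicalType)
    (mul : G -> G -> G) (inv : G -> G) (e : G) : Prop :=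
  [/\ (forall x y z, mul x (mul y z) = mul (mul x y) z),
      (forall x, mul e x = x /\ mul x e = x),
      (forall x, mul (inv x) x = e /\ mul x (inv x) = e),
      continuous (fun p : G * G => mul p.1 p.2) &
      continuous inv].

Definition is_subgroup (G : Type) (mul : G -> G -> G) (inv : G -> G) (e : G)
    (H : set G) : Prop :=
  [/\ H e, (forall x y, H x -> H y -> H (mul x y)) & (forall x, H x -> H (inv x))].

Definition non_archimedean (G : topologicalType)
    (mul : G -> G -> G) (inv : G -> G) (e : G) : Prop :=
  hausdorff_space G /\
  forall U : set G, nbhs e U ->
    exists H : set G, [/\ open H, is_subgroup mul inv e H & H `<=` U].

Definition complete_compatible_metric (R : realType) (T : topologicalType)
    (d : T -> T -> R) : Prop :=
  (forall x y, 0 <= d x y) /\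
  (forall x y, d x y = 0 <-> x = y) /\
  (forall x y, d x y = d y x) /\
  (forall x y z, d x z <= d x y + d y z) /\
  (forall A : set T, open A <->
     (forall x, A x -> exists2 eps : R, 0 < eps & [set y | d x y < eps] `<=` A)) /\
  (forall u : nat -> T,
     (forall eps : R, 0 < eps -> exists N : nat, forall m n : nat,
         (N <= m)%N -> (N <= n)%N -> d (u m) (u n) < eps) ->
     exists l : T, u @ \oo --> l).

Definition polish_space (R : realType) (T : topologicalType) : Prop :=
  (exists D : set T, countable D /\ closure D = [set: T]) /\
  (exists d : T -> T -> R, complete_compatible_metric d).

Definition continuous_action (G X : topologicalType) (mul : G -> G -> G) (e : G)
    (act : G -> X -> X) : Prop :=
  [/\ (forall x, act e x = x),
      (forall g h x, act (mul g h) x = act g (act h x)) &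
      continuous (fun p : G * X => act p.1 p.2)].

Notation borel_type X := (g_sigma_algebraType (@open X)).

Definition invariant_measure (R : realType) (G : topologicalType) (X : ptopologicalType)
    (act : G -> X -> X) (mu : probability (borel_type X) R) : Prop :=
  forall (g : G) (A : set X), <<s @open X >> A -> mu (act g @^-1` A) = mu A.

Definition regular_measure (R : realType) (X : ptopologicalType)
    (mu : probability (borel_type X) R) : Prop :=
  forall A : set X, <<s @open X >> A ->
    mu A = ereal_sup [set mu K | K in [set K : set X | compact K /\ K `<=` A]] /\
    mu A = ereal_inf [set mu U | U in [set U : set X | open U /\ A `<=` U]].

Definition amenable (R : realType) (G : topologicalType) (mul : G -> G -> G) (e : G)
    : Prop :=
  forall (X : ptopologicalType) (act : G -> X -> X),
    compact [set: X] -> hausdorff_space X -> continuous_action mul e act ->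
    exists mu : probability (borel_type X) R,
      invariant_measure act mu /\ regular_measure mu.

(* Main.v *)
Require Import Defs.
From HB Require Import structures.
From mathcomp Require Import all_boot all_order all_algebra.
From mathcomp Require Import all_classical all_reals all_analysis.
From mathcomp Require Import lra.
Set Implicit Arguments.
Unset Strict Implicit.
Unset Printing Implicit Defensive.
Import Order.TTheory GRing.Theory Num.Theory.
Import numFieldNormedType.Exports.
Local Open Scope classical_set_scope.
Local Open Scope ring_scope.

(** One implication holds because the Cantor space is compact and Hausdorff.

    For the other one, let [m] be a set function on the subsets of [G] that is
    monotone, finitely subadditive, left invariant, of total mass [1], and such
    that [m (S `|` T) = m S + m T] whenever [S] and [T] are separated by a set
    [A] with [V A = A] for some open subgroup [V].  Given a compact flow [X] and
    a point [x0], the pushforward of [m] along [g |-> g x0] is additive on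
    disjoint closed sets: since [G] is non-archimedean and [X] compact, disjoint
    closed sets [C] and [D] have [V C] disjoint from [D] for some open subgroup
    [V].  The usual passage from contents to outer measures then produces an
    invariant regular Borel probability measure.

    By an ultrafilter limit, it suffices to find [m] for finitely many sets
    [A_i], all fixed by one open subgroup [V].  As [G] is separable, [G / V] is
    countable, and the indicators [h |-> (h \in g A_i)], for [g V] in [G / V],
    map [G] equivariantly into a Cantor space.  The orbit closure [Y] carries an
    invariant measure [mu], and [m S] is the [mu]-measure of the closure of the
    image of [S]. *)

(** * Regular measures from contents *)

Section measure_of_content.
Local Open Scope ereal_scope.
Context (R : realType) (X : ptopologicalType) (m : set X -> R).
Hypotheses (cptX : compact [set: X]) (hsdfX : hausdorff_space X).
Hypotheses (m0 : m set0 = 0%R) (mT : m setT = 1%R).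
Hypothesis m_le : forall S T, S `<=` T -> (m S <= m T)%R.
Hypothesis m_subU : forall S T, (m (S `|` T) <= m S + m T)%R.
Hypothesis m_addU : forall C D, closed C -> closed D -> C `&` D = set0 ->
  (m C + m D <= m (C `|` D))%R.

(** As in the Riesz construction, only the values of [m] on closed sets matter. On a closed set the
    resulting measure may exceed [m], but is never smaller. *)
Definition inner_content (U : set X) : \bar R :=
  ereal_sup [set (m C)%:E | C in [set C | closed C /\ C `<=` U]].

Definition outer_content (E : set X) : \bar R :=
  ereal_inf [set inner_content U | U in [set U | open U /\ E `<=` U]].

Lemma le_inner_content_closed C U :
  closed C -> C `<=` U -> (m C)%:E <= inner_content U.
Proof. by move=> clC CU; apply: ereal_sup_ubound; exists C. Qed.

Lemma inner_content_le (U : set X) x :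
  (forall C, closed C -> C `<=` U -> (m C)%:E <= x) -> inner_content U <= x.
Proof. by move=> h; apply: ge_ereal_sup => _ [C [clC CU] <-]; exact: h. Qed.

Lemma inner_content_ge0 U : 0 <= inner_content U.
Proof.
rewrite -[0]/(0%R%:E) -m0.
by apply: le_inner_content_closed => //; exact: closed0.
Qed.

Lemma inner_content_le1 U : inner_content U <= 1.
Proof. by apply: inner_content_le => C _ _; rewrite lee_fin -mT m_le. Qed.

Lemma inner_content_fin U : inner_content U \is a fin_num.
Proof.
rewrite ge0_fin_numE ?inner_content_ge0//.
by rewrite (le_lt_trans (inner_content_le1 U)) ?ltry.
Qed.

Lemma le_inner_content U V : U `<=` V -> inner_content U <= inner_content V.
Proof.
move=> UV; apply: inner_content_le => C clC CU.
by apply: le_inner_content_closed => //; exact: subset_trans UV.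
Qed.

Lemma inner_content0 : inner_content set0 = 0.
Proof.
apply/eqP; rewrite eq_le inner_content_ge0 andbT.
by apply: inner_content_le => C _; rewrite subset0 => ->; rewrite m0.
Qed.

Lemma inner_contentT : inner_content setT = 1.
Proof.
apply/eqP; rewrite eq_le inner_content_le1/=.
by rewrite -mT; apply: le_inner_content_closed => //; exact: closedT.
Qed.

(* A closed subset of [U `|` V] is covered by a closed subset of [U] and one of
   [V]: normality gives a closed neighbourhood of [C `\` V] inside [U]. *)
Lemma inner_contentU U V : open U -> open V ->
  inner_content (U `|` V) <= inner_content U + inner_content V.
Proof.
move=> oU oV; apply: inner_content_le => C clC CUV.
have clCV : closed (C `\` V).
  by rewrite setDE; apply: closedI => //; exact: open_closedC.
have [|B /= snB BU] := compact_normal hsdfX cptX clCV (_ : set_nbhs _ U).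
  by apply/set_nbhsP; exists U; split => // x [/CUV[]].
have [W [oW CW WB]] := (set_nbhsP _ _).1 snB.
have clCW : closed (C `\` W).
  by rewrite setDE; apply: closedI => //; exact: open_closedC.
have CE : C `<=` closure B `|` (C `\` W).
  move=> x Cx; have [Wx|nWx] := pselect (W x).
    by left; apply: subset_closure; exact: WB.
  by right.
apply: (@le_trans _ _ ((m (closure B))%:E + (m (C `\` W))%:E)).
  by rewrite -EFinD lee_fin (le_trans (m_le CE))// m_subU.
apply: leeD; first exact: le_inner_content_closed (@closed_closure _ _) BU.
apply: le_inner_content_closed => // x [Cx nWx].
by apply: contrapT => nVx; apply: nWx; exact: CW.
Qed.

(** A closed subset of the union is compact, so it already lies in a finite partial union, where
    finite subadditivity applies. *)
Lemma inner_content_bigcup (U : nat -> set X) : (forall n, open (U n)) ->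
  inner_content (\bigcup_n U n) <= \sum_(n <oo) inner_content (U n).
Proof.
move=> oU; apply: inner_content_le => C clC CU.
have /compact_near_coveringP cvC : compact C.
  by apply: (subclosed_compact clC cptX).
have [|n _ /(_ n (leqnn n)) Cn] :=
    cvC nat \oo (fun n => \big[setU/set0]_(i < n) U i) _.
  move=> x /CU[i _ Uix]; exists (U i, [set n | (i < n)%N]).
    by split => /=; [exact: open_nbhs_nbhs | exists i.+1].
  move=> [y n] [/= Uiy ilt]; rewrite -bigcup_mkord.
  by exists i.
apply: (@le_trans _ _ (\sum_(i < n) inner_content (U i))); last first.
  rewrite -(big_mkord xpredT (fun i => inner_content (U i))).
  by apply: nneseries_lim_ge => i _ _; exact: inner_content_ge0.
apply: (le_trans (le_inner_content_closed clC Cn)).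
elim: n {Cn} => [|n ih]; first by rewrite !big_ord0 inner_content0.
rewrite !big_ord_recr/=; apply: le_trans (inner_contentU _ (oU n)) _.
  by rewrite -bigcup_mkord; apply: bigcup_open => i _; exact: oU.
by rewrite leeD2r.
Qed.

Lemma outer_content_open U : open U -> outer_content U = inner_content U.
Proof.
move=> oU; apply/eqP; rewrite eq_le; apply/andP; split.
  by apply: ereal_inf_lbound; exists U => //; split.
by apply: le_ereal_inf_tmp => _ [V [oV UV] <-]; exact: le_inner_content.
Qed.

Lemma outer_content_ge0 E : 0 <= outer_content E.
Proof. by apply: le_ereal_inf_tmp => _ [V _ <-]; exact: inner_content_ge0. Qed.

Lemma outer_content0 : outer_content set0 = 0.
Proof. by rewrite outer_content_open ?inner_content0//; exact: open0. Qed.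

Lemma outer_contentT : outer_content setT = 1.
Proof. by rewrite outer_content_open ?inner_contentT//; exact: openT. Qed.

Lemma le_outer_content : {homo outer_content : A B / A `<=` B >-> A <= B}.
Proof.
move=> A B AB; apply: le_ereal_inf_tmp => _ [U [oU BU] <-].
by apply: ereal_inf_lbound; exists U => //; split => //; exact: subset_trans BU.
Qed.

Lemma outer_content_fin E : outer_content E \is a fin_num.
Proof.
rewrite ge0_fin_numE ?outer_content_ge0//.
by rewrite (@le_lt_trans _ _ 1) ?ltry// -outer_contentT le_outer_content.
Qed.

Lemma outer_content_adherent E (e : R) : (0 < e)%R ->
  exists U, [/\ open U, E `<=` U & inner_content U <= outer_content E + e%:E].
Proof.
move=> e0; have [_ [U [oU EU] <-] /ltW lt] :=
  lb_ereal_inf_adherent e0 (outer_content_fin E).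
by exists U.
Qed.

Lemma outer_content_sigma_subadditive : sigma_subadditive outer_content.
Proof.
move=> A; apply/lee_addgt0Pr => e e0.
apply: le_trans (epsilon_trick xpredT _ (ltW e0)); last first.
  by move=> n; exact: outer_content_ge0.
pose P n V := [/\ open V, A n `<=` V &
  inner_content V <= outer_content (A n) + (e / (2 ^ n.+1)%:R)%:E].
have [U UP] : {U : nat -> set X & forall n, P n (U n)}.
  apply: (@choice _ _ P) => n; apply: outer_content_adherent.
  by rewrite divr_gt0// ltr0n expn_gt0.
have oU n : open (U n) by case: (UP n).
apply: (@le_trans _ _ (inner_content (\bigcup_n U n))).
  apply: ereal_inf_lbound; exists (\bigcup_n U n) => //; split.
    exact: bigcup_open.
  by apply: subset_bigcup => n _; case: (UP n).
apply: (le_trans (inner_content_bigcup oU)).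
apply: lee_nneseries => n _; first by move=> _; exact: inner_content_ge0.
by case: (UP n).
Qed.

HB.instance Definition _ := isOuterMeasure.Build R X outer_content
  outer_content0 outer_content_ge0 le_outer_content
  outer_content_sigma_subadditive.

(** Choose a closed [C] inside [O] and [U], then a closed [D] inside [O] minus [C]. They are
    disjoint, so [m_addU] bounds the sum of their contents by that of [C] union [D], which lies in
    [O]. This is the only appeal to additivity of [m]. *)
Lemma inner_content_split O U : open O -> open U ->
  inner_content (O `&` U) + outer_content (O `&` ~` U) <= inner_content O.
Proof.
move=> oO oU; rewrite -leeBrDr ?outer_content_fin//.
apply: inner_content_le => C clC COU.
rewrite leeBrDr ?outer_content_fin// -leeBrDl//.
have oOC : open (O `&` ~` C) by apply: openI => //; exact: closed_openC.
apply: (@le_trans _ _ (inner_content (O `&` ~` C))).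
  apply: ereal_inf_lbound; exists (O `&` ~` C) => //; split => //.
  by move=> x [Ox nUx]; split => // /COU[].
apply: inner_content_le => D clD DO.
rewrite leeBrDl// -EFinD.
apply: (@le_trans _ _ (m (C `|` D))%:E).
  by rewrite lee_fin m_addU//; apply/seteqP; split => // x [Cx /DO[]].
apply: le_inner_content_closed; first exact: closedU.
by move=> x [/COU[]|/DO[]].
Qed.

(** An arbitrary test set [E] is replaced by an open superset [W] of almost the same outer content,
    to which [inner_content_split] applies. *)
Lemma open_caratheodory U : open U -> outer_content.-caratheodory U.
Proof.
move=> oU; apply: le_caratheodory_measurable => E.
apply/lee_addgt0Pr => e /(outer_content_adherent E)[W [oW EW]].
apply: le_trans; apply: le_trans (inner_content_split oW oU).
apply: leeD; last by apply: le_outer_content; exact: setSI.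
rewrite -outer_content_open; last exact: openI.
by apply: le_outer_content; exact: setSI.
Qed.

Lemma borel_caratheodory : <<s @open X >> `<=` outer_content.-caratheodory.
Proof.
apply: smallest_sub; last by move=> U; exact: open_caratheodory.
split.
- exact: caratheodory_measurable_set0.
- move=> A mA; rewrite setTD.
  exact: (@caratheodory_measurable_setC _ _ outer_content).
- exact: (@caratheodory_measurable_bigcup _ _ outer_content).
Qed.

(** Retyping [outer_content] selects the Borel sigma-algebra in place of the larger Caratheodory
    one. *)
Definition content_measure : set (borel_type X) -> \bar R := outer_content.

Lemma content_measure_semi_sigma_additive : semi_sigma_additive content_measure.
Proof.
move=> F mF tF mUF.
apply: (@caratheodory_measure_sigma_additive _ X outer_content) => //.
  by move=> i; exact: borel_caratheodory (mF i).
exact: borel_caratheodory mUF.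
Qed.

HB.instance Definition _ := isMeasure.Build _ _ _ content_measure
  outer_content0 outer_content_ge0 content_measure_semi_sigma_additive.

HB.instance Definition _ :=
  Measure_isProbability.Build _ _ _ content_measure outer_contentT.

(** Outer regularity is built into [outer_content]. Inner regularity follows by complementation, the
    total mass being finite: if an open [U] approximates the complement of [A] from outside, then
    the complement of [U] is a compact subset approximating [A]. *)
Lemma content_measure_regular : regular_measure content_measure.
Proof.
have outer A : outer_content A =
    ereal_inf [set outer_content U | U in [set U | open U /\ A `<=` U]].
  rewrite [LHS]/outer_content; congr ereal_inf.
  by apply/seteqP; split => _ [U [oU AU] <-]; exists U => //;
    rewrite outer_content_open.
move=> A bA; split; last exact: outer.
apply/eqP; rewrite eq_le; apply/andP; split; last first.
  by apply: ge_ereal_sup => _ [K [_ KA] <-]; exact: le_outer_content.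
apply/lee_addgt0Pr => e /(outer_content_adherent (~` A))[U [oU AU Ue]].
have mA : measurable (A : set (borel_type X)) by [].
have mU : measurable (U : set (borel_type X)) by exact: sub_gen_smallest.
have clU : closed (~` U) by exact: open_closedC.
rewrite -leeBlDr// -[X in X - _]/(outer_content A).
apply: (@le_trans _ _ (outer_content (~` U))); last first.
  apply: ereal_sup_ubound; exists (~` U) => //; split.
    exact: (subclosed_compact clU cptX).
  by apply: subsetCl.
rewrite -outer_content_open// in Ue.
have -> : outer_content (~` U) = 1 - outer_content U.
  exact: (probability_setC content_measure mU).
have : outer_content (~` A) = 1 - outer_content A.
  exact: (probability_setC content_measure mA).
move: Ue (outer_content_fin (~` A)) (outer_content_fin A) (outer_content_fin U).
case: (outer_content (~` A)) => [a| |]//; case: (outer_content A) => [b| |]//.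
case: (outer_content U) => [c| |]// + _ _ _ + => /[swap] -[->].
by rewrite -?EFinB -?EFinD !lee_fin; lra.
Qed.

Lemma inner_content_preimage (phi : X -> X) U : continuous phi ->
  (forall C, closed C -> m (phi @^-1` C) = m C) ->
  inner_content U <= inner_content (phi @^-1` U).
Proof.
move=> cphi mphi; apply: inner_content_le => C clC CU.
rewrite -mphi//; apply: le_inner_content_closed; last by move=> x /CU.
by move/continuous_closedP : cphi; exact.
Qed.

Lemma outer_content_preimage_le (phi psi : X -> X) E :
  continuous phi -> continuous psi -> cancel psi phi ->
  (forall C, closed C -> m (psi @^-1` C) = m C) ->
  outer_content (phi @^-1` E) <= outer_content E.
Proof.
move=> cphi cpsi psiK mpsi; apply: le_ereal_inf_tmp => _ [U [oU EU] <-].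
apply: (@le_trans _ _ (inner_content (phi @^-1` U))).
  apply: ereal_inf_lbound; exists (phi @^-1` U) => //; split.
    by move/continuousP : cphi; exact.
  by move=> x /EU.
apply: le_trans (inner_content_preimage _ cpsi mpsi) _.
by apply: le_inner_content => x /=; rewrite psiK.
Qed.

(** Both inequalities come from [outer_content_preimage_le]: once for [phi] and [E], once for [psi]
    and the preimage of [E]. Invariance of [m] under [psi] follows from that under [phi]. *)
Lemma outer_content_homeomorphism (phi psi : X -> X) E :
  continuous phi -> continuous psi -> cancel phi psi -> cancel psi phi ->
  (forall C, closed C -> m (phi @^-1` C) = m C) ->
  outer_content (phi @^-1` E) = outer_content E.
Proof.
move=> cphi cpsi phiK psiK mphi; apply/eqP; rewrite eq_le; apply/andP; split.
  apply: (outer_content_preimage_le E cphi cpsi psiK) => C clC.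
  rewrite -[LHS]mphi; last by move/continuous_closedP : cpsi; exact.
  by congr m; apply/seteqP; split => x /=; rewrite phiK.
have := outer_content_preimage_le (phi @^-1` E) cpsi cphi phiK mphi.
by congr (outer_content _ <= _); apply/seteqP; split => x /=; rewrite psiK.
Qed.

Lemma regular_probability_of_content :
  exists mu : probability (borel_type X) R, regular_measure mu /\
    forall phi psi : X -> X, continuous phi -> continuous psi ->
      cancel phi psi -> cancel psi phi ->
      (forall C, closed C -> m (phi @^-1` C) = m C) ->
      forall A, mu (phi @^-1` A) = mu A.
Proof.
exists content_measure; split; first exact: content_measure_regular.
move=> phi psi cphi cpsi phiK psiK mphi A.
exact: outer_content_homeomorphism psiK mphi.
Qed.

End measure_of_content.

(** * Flows on closed subsets of the Cantor space *)

Lemma continuous_pairl (T U W : topologicalType) (f : T * U -> W) (x : T) :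
  continuous f -> continuous (fun y => f (x, y)).
Proof.
move=> cf y; have cp : {for y, continuous (fun y : U => (x, y))}.
  exact: (cvg_pair (cvg_cst x) cvg_id).
exact: (continuous_comp cp (cf (x, y))).
Qed.

Lemma continuous_pairr (T U W : topologicalType) (f : T * U -> W) (y : U) :
  continuous f -> continuous (fun x => f (x, y)).
Proof.
move=> cf x; have cp : {for x, continuous (fun x : T => (x, y))}.
  exact: (cvg_pair cvg_id (cvg_cst y)).
exact: (continuous_comp cp (cf (x, y))).
Qed.

Lemma closure_continuous_sub (T U : topologicalType) (f : T -> U)
    (A : set T) (B : set U) x : continuous f ->
  (forall a, A a -> B (f a)) -> closure A x -> closure B (f x).
Proof.
by move=> cf AB Ax N /cf/Ax[a [Aa Na]]; exists (f a); split => //; exact: AB.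
Qed.

(** Serves to extend the action laws from a dense orbit to its closure. *)
Lemma continuous_closure_eq (T U : topologicalType) (f g : T -> U) (A : set T) :
  hausdorff_space U -> continuous f -> continuous g ->
  (forall a, A a -> f a = g a) -> forall x, closure A x -> f x = g x.
Proof.
move=> hU cf cg fg x Ax; apply: hU => P Q nP nQ.
have fP : nbhs x (f @^-1` P) by exact: cf.
have gQ : nbhs x (g @^-1` Q) by exact: cg.
have [a [Aa [Pa Qa]]] := Ax _ (filterI fP gQ).
by exists (f a); split => //; rewrite fg.
Qed.

Lemma continuous_cantorP (T : topologicalType) (f : T -> cantor_space) :
  (forall t k, \forall u \near t, f u k = f t k) -> continuous f.
Proof.
move=> fk t; apply/cvg_sup => k U [_ [[W oW <-] /= Wf WU]].
by apply: filterS (fk t k) => u fu; apply: WU; rewrite /= fu.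
Qed.

Lemma cantor_coord_near (y : cantor_space) k : \forall z \near y, z k = y k.
Proof.
have := @proj_continuous nat (fun=> bool) k y.
by move=> /(_ [set y k]); apply; exact: discrete_set1.
Qed.

Lemma closed_borel (X : topologicalType) (C : set X) :
  closed C -> <<s @open X >> C.
Proof.
move=> clC; rewrite -(setCK C) -setTD; apply: sigma_algebraCD.
by apply: sub_sigma_algebra; exact: closed_openC.
Qed.

Lemma compact_set_type (X : topologicalType) (A : set X) :
  compact A -> compact [set: A].
Proof.
move=> cA F PF _.
have [|p [Ap clp]] := cA (set_val @ F) _.
  by apply: nearW => -[x xA]; exact: set_mem.
exists (exist _ p (mem_set Ap)); split => // P Q FP [_ [[W oW <-] Wp WQ]].
have FvP : F (set_val @^-1` (set_val @` P)).
  by apply: filterS FP => a Pa; exists a.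
have [_ [[a Pa <-] Wa]] := clp _ W FvP (open_nbhs_nbhs (conj oW Wp)).
by exists a; split => //; exact: WQ.
Qed.

(** Compactness and zero-dimensionality come from both factors; the absence of isolated points comes
    from the second one alone. *)
Lemma cantor_like_setX_cantor (Y : set {ptws nat -> bool}) : closed Y ->
  cantor_like (Y `*` [set: {ptws nat -> bool}] : set (_ * _)).
Proof.
move=> clY; set Z := Y `*` _.
have cval : continuous (set_val : Z -> _) by exact: initial_continuous.
have val_neq (x y : Z) : x != y -> set_val x != set_val y.
  by apply: contra_neq => /val_inj.
have zdP : zero_dimensional ({ptws nat -> bool} * {ptws nat -> bool})%type.
  move=> [x1 x2] [y1 y2] xy.
  have [x1y1|x1y1] := eqVneq x1 y1.
    have [|U [cU Ux Uy]] := @cantor_zero_dimensional x2 y2.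
      by apply: contra_neq xy => ->; rewrite x1y1.
    exists (snd @^-1` U); split => //.
    by apply: preimage_clopen => // p; exact: cvg_snd.
  have [U [cU Ux Uy]] := @cantor_zero_dimensional x1 y1 x1y1.
  exists (fst @^-1` U); split => //.
  by apply: preimage_clopen => // p; exact: cvg_fst.
have zdZ : zero_dimensional Z.
  move=> x y /val_neq/zdP[U [cU Ux Uy]].
  by exists (set_val @^-1` U); split => //; exact: preimage_clopen.
split => //.
- apply/perfectTP_ex => _ [W oW <-] [[[y z] yzZ] /= Wyz].
  have /= Yy : Y y by have [] := set_mem yzZ.
  (* Two distinct points of [W] are found in the fibre over [y], a copy of the Cantor space. *)
  have [||a [b [Wa Wb ab]]] := (iffLR perfectTP_ex) cantor_perfect
      [set z' : cantor_space | W (y, z')].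
  + have : continuous (fun z' : cantor_space => (y, z')).
      by move=> z'; exact: (cvg_pair (cvg_cst y) cvg_id).
    by move/continuousP; apply.
  + by exists z.
  + have Zy c : (y, c) \in Z by apply: mem_set.
    exists (exist _ (y, a) (Zy a)), (exist _ (y, b) (Zy b)); split => //.
    by apply: contra_neq ab => -[].
- apply: compact_set_type; apply: compact_setX; last exact: cantor_space_compact.
  exact: (subclosed_compact clY cantor_space_compact).
- rewrite open_hausdorff => x y /zdZ[U [[oU cU] Ux Uy]].
  exists (U, ~` U) => /=; first by split; exact: mem_set.
  by split => //; [exact: closed_openC | rewrite setICr].
Qed.

(* A closed invariant subset [Y] may have isolated points, but [Y] times the
   Cantor space, with the trivial action on the second factor, is a Cantor
   space. *)
Lemma invariant_probability_subflow (R : realType) (G : topologicalType)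
    (mul : G -> G -> G) (e : G) (Y : set cantor_space)
    (s : G -> cantor_space -> cantor_space) :
  (forall act : G -> cantor_space -> cantor_space,
    continuous_action mul e act ->
    exists mu : probability (borel_type cantor_space) R,
      invariant_measure act mu) ->
  closed Y -> Y !=set0 -> (forall g y, Y y -> Y (s g y)) ->
  continuous (fun p : G * cantor_space => s p.1 p.2) ->
  (forall y, Y y -> s e y = y) ->
  (forall g h y, Y y -> s (mul g h) y = s g (s h y)) ->
  exists (mu : probability (borel_type cantor_space) R)
         (f : cantor_space -> cantor_space),
    [/\ continuous f, forall c, Y (f c) &
      forall g C, closed C -> mu (f @^-1` (s g @^-1` C)) = mu (f @^-1` C)].
Proof.
move=> cantor_amenable clY [y0 Yy0] sY cs s1 sM.
pose W : set ({ptws nat -> bool} * {ptws nat -> bool}) := Y `*` setT.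
have z0W : (y0, y0) \in W by apply: mem_set.
(* The topological characterization of the Cantor space is applied to a pointed space, whence the
   base point built from [y0]. *)
pose Z : pseudoPMetricType R :=
  HB.pack (set_type W) (isPointed.Build (set_type W) (exist _ (y0, y0) z0W)).
have [f [cf clf]] :=
  @homeomorphism_cantor_like R Z (cantor_like_setX_cantor clY).
pose k (c : cantor_space) : cantor_space * cantor_space :=
  set_val (f c : set_type W).
have ck : continuous k.
  by move=> c; apply: (continuous_comp (cf c)); exact: initial_continuous.
have ck1 : continuous (fun c => (k c).1).
  by move=> c; apply: (continuous_comp (ck c)); exact: cvg_fst.
have ck2 : continuous (fun c => (k c).2).
  by move=> c; apply: (continuous_comp (ck c)); exact: cvg_snd.
have Yk c : Y (k c).1 by have [] := set_valP (f c : set_type W).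
have skW g c : (s g (k c).1, (k c).2) \in W.
  by apply: mem_set; split => //=; exact: sY.
pose F (p : G * cantor_space) : set_type W :=
  exist (fun x => x \in W) (s p.1 (k p.2).1, (k p.2).2) (skW p.1 p.2).
have cF : continuous F.
  apply: continuous_comp_initial => p.
  have c1 : {for p, continuous (fun p : G * cantor_space => (k p.2).1)}.
    exact: (@continuous_comp _ _ _ snd (fun c => (k c).1) p cvg_snd (ck1 _)).
  have c2 : {for p, continuous (fun p : G * cantor_space => (k p.2).2)}.
    exact: (@continuous_comp _ _ _ snd (fun c => (k c).2) p cvg_snd (ck2 _)).
  have c3 : {for p, continuous (fun p : G * cantor_space => (p.1, (k p.2).1))}.
    exact: (cvg_pair cvg_fst c1).
  exact: (cvg_pair (continuous_comp c3 (cs _)) c2).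
pose finv : Z -> cantor_space := f^-1%FUN.
have fK : cancel f finv by move=> c; apply: funK; rewrite inE.
have finvK : cancel finv f by move=> z; apply: invK; rewrite inE.
have cfinv : continuous finv.
  apply/continuous_closedP => A /clf; congr closed.
  apply/seteqP; split => z /=; first by move=> [c Ac <-]; rewrite fK.
  by move=> Az; exists (finv z) => //; rewrite finvK.
(* The product action, conjugated by the homeomorphism [f]. The laws of [s] hold only on [Y], which
   suffices since first coordinates stay in [Y]. *)
pose act g c := finv (F (g, c)).
have kact g c : k (act g c) = (s g (k c).1, (k c).2) by rewrite /k finvK.
have [|mu muP] := cantor_amenable act.
  split.
  - move=> c; rewrite /act -[RHS]fK; congr finv; apply: val_inj => /=.
    by rewrite s1// -surjective_pairing.
  - move=> g h c; rewrite {1 2}/act; congr finv; apply: val_inj => /=.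
    by rewrite kact/= sM.
  - by move=> p; apply: (continuous_comp (cF (p.1, p.2))); exact: cfinv.
(* The projection to [Y] intertwines [act g] with [s g], so invariance of [mu] passes to preimages
   of closed sets. *)
exists mu, (fun c => (k c).1); split => // g C clC.
rewrite -(muP g ((fun c => (k c).1) @^-1` C)).
  by congr (mu _); apply/seteqP; split => c /=; rewrite kact.
by apply: closed_borel; move/continuous_closedP : ck1; exact.
Qed.

(** * The flow attached to finitely many subsets of the group *)

(** Only the superadditive half is recorded; the converse inequality is [submeasureU]. *)
Definition additive_across (G : Type) (R : realType) (m : set G -> R)
    (A : set G) : Prop :=
  forall S T, S `<=` A -> T `<=` ~` A -> m S + m T <= m (S `|` T).

Record invariant_submeasure (R : realType) (G : Type) (mul : G -> G -> G)
    (m : set G -> R) : Prop := InvariantSubmeasure {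
  submeasure0 : m set0 = 0 ;
  submeasureT : m setT = 1 ;
  le_submeasure : forall S T, S `<=` T -> m S <= m T ;
  submeasureU : forall S T, m (S `|` T) <= m S + m T ;
  submeasure_invariant : forall g S, m (mul g @` S) = m S }.

Section coset_flow.
Context (R : realType) (G : topologicalType).
Context (mul : G -> G -> G) (inv : G -> G) (e : G).
Hypothesis topG : topological_group mul inv e.

Let mulA x y z : mul x (mul y z) = mul (mul x y) z. Proof. by case: topG. Qed.
Let mul1 x : mul e x = x. Proof. by case: topG => _ /(_ x)[]. Qed.
Let mulV x : mul (inv x) x = e. Proof. by case: topG => _ _ /(_ x)[]. Qed.
Let mulxV x : mul x (inv x) = e. Proof. by case: topG => _ _ /(_ x)[]. Qed.
Let mulK x y : mul (inv x) (mul x y) = y. Proof. by rewrite mulA mulV mul1. Qed.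
Let mulVK x y : mul x (mul (inv x) y) = y. Proof. by rewrite mulA mulxV mul1. Qed.
Let mul_continuous : continuous (fun p : G * G => mul p.1 p.2).
Proof. by case: topG. Qed.
Let mull_continuous x : continuous (mul x) := continuous_pairl mul_continuous.
Let mulr_continuous y : continuous (mul^~ y) := continuous_pairr mul_continuous.

Context (d : nat -> G) (V : set G) (A : nat -> set G).
Hypothesis dense_d : forall U, open U -> U !=set0 -> exists n, U (d n).
Hypotheses (oV : open V) (V_subgroup : is_subgroup mul inv e V).
Hypothesis AV : forall i v g, V v -> A i g -> A i (mul v g).

Let AVE i v g : V v -> A i (mul v g) <-> A i g.
Proof.
move=> Vv; split=> [|/AV]; last exact.
have [_ _ /(_ _ Vv) Vv'] := V_subgroup.
by move=> /(AV Vv'); rewrite mulK.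
Qed.

(* Indices [j] with [d j] in the coset [h^-1 (d n) V]. *)
Definition coset_indices h n : set nat :=
  [set j | V (mul (inv (d n)) (mul h (d j)))].

(** Cosets of [V] are indexed by the dense sequence, possibly with repetition, so an index must be
    chosen. The default [0] never intervenes: the coset is open and nonempty, hence meets the
    sequence. *)
Definition coset_shift h n : nat := xget 0%N (coset_indices h n).

Lemma coset_shiftP h n : V (mul (inv (d n)) (mul h (d (coset_shift h n)))).
Proof.
apply: (@xgetPex _ _ (coset_indices h n)).
have cf : continuous (fun x => mul (inv (d n)) (mul h x)).
  move=> x; apply: (continuous_comp _ (@mull_continuous _ _)).
  exact: mull_continuous.
have [||j] := dense_d (U := (fun x => mul (inv (d n)) (mul h x)) @^-1` V).
- by move/continuousP : cf; exact.
- by exists (mul (inv h) (d n)); rewrite /= mulVK mulV; case: V_subgroup.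
- by exists j.
Qed.

(** If [h'] is so close to [h] that [h' h^-1] lies in the open subgroup [(d n) V (d n)^-1], then [h]
    and [h'] have the same index set, and [xget] makes the same choice. *)
Lemma coset_shift_near h n :
  \forall h' \near h, coset_shift h' n = coset_shift h n.
Proof.
have cf : continuous (fun h' => mul (inv (d n)) (mul (mul h' (inv h)) (d n))).
  move=> x; apply: (continuous_comp _ (@mull_continuous _ _)).
  exact: (continuous_comp (@mulr_continuous (inv h) x) (@mulr_continuous _ _)).
have : nbhs h ((fun h' => mul (inv (d n)) (mul (mul h' (inv h)) (d n))) @^-1` V).
  apply: cf; apply: open_nbhs_nbhs; split => //.
  by rewrite mulxV mul1 mulV; case: V_subgroup.
apply: filterS => h' /= Vh'; rewrite /coset_shift; congr xget.
have [_ VM VV] := V_subgroup.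
apply/seteqP; split => j /= Vj.
  have := VM _ _ (VV _ Vh') Vj; congr V.
  rewrite -[RHS](mulK (mul (inv (d n)) (mul (mul h' (inv h)) (d n)))).
  by congr mul; rewrite -!mulA mulVK mulK.
have := VM _ _ Vh' Vj; congr V.
by rewrite -!mulA mulVK mulK.
Qed.

(** The coordinate coded by [(n, i)] tells whether [h] lies in [(d n) (A i)], a set depending only
    on the coset [(d n) V]. *)
Definition itinerary (h : G) : cantor_space := fun k =>
  if (unpickle k : option (nat * nat)) is Some (n, i)
  then `[< A i (mul (inv (d n)) h) >] else false.

(** Defined on the whole Cantor space, but the action laws are claimed only on the orbit closure:
    elsewhere two indices of one coset may carry different values. *)
Definition shift (h : G) (y : cantor_space) : cantor_space := fun k =>
  if (unpickle k : option (nat * nat)) is Some (n, i)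
  then y (pickle (coset_shift h n, i)) else false.

(** The chosen index and the exact translate differ by a left factor in [V], which does not affect
    membership in [A i]. *)
Lemma shift_itinerary g h : shift g (itinerary h) = itinerary (mul g h).
Proof.
apply/funext => k; rewrite /shift /itinerary.
case: (unpickle k) => [[n i]|]//=; rewrite pickleK; apply: asbool_equiv_eq.
have -> : mul (inv (d n)) (mul g h) =
    mul (mul (inv (d n)) (mul g (d (coset_shift g n))))
        (mul (inv (d (coset_shift g n))) h) by rewrite -!mulA mulVK.
by apply: iff_sym; apply: AVE; exact: coset_shiftP.
Qed.

Lemma shift_continuous : continuous (fun p : G * cantor_space => shift p.1 p.2).
Proof.
apply: continuous_cantorP => -[h y] k; rewrite /shift /=.
case: (unpickle k) => [[n i]|]; last by near=> p.
have nh : \forall p \near (h, y), coset_shift p.1 n = coset_shift h n.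
  exact: (@cvg_fst _ _ (nbhs h) (nbhs y) _ _ (coset_shift_near h n)).
have ny : \forall p \near (h, y),
    p.2 (pickle (coset_shift h n, i)) = y (pickle (coset_shift h n, i)).
  exact: (@cvg_snd _ _ (nbhs h) (nbhs y) _ _ (cantor_coord_near y _)).
by apply: filterS2 nh ny => p /= -> ->.
Unshelve. all: by end_near. Qed.

Lemma shift_continuousr g : continuous (shift g).
Proof. exact: continuous_pairl shift_continuous. Qed.

Lemma shift_closure g S y : closure (itinerary @` S) y ->
  closure (itinerary @` (mul g @` S)) (shift g y).
Proof.
apply: closure_continuous_sub; first exact: shift_continuousr.
move=> _ [h Sh <-]; rewrite shift_itinerary.
by exists (mul g h) => //; exists h.
Qed.

Lemma shift_orbit_closure g y :
  closure (range itinerary) y -> closure (range itinerary) (shift g y).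
Proof.
by move=> /(@shift_closure g); apply: closureS => _ [h _ <-]; exists h.
Qed.

Lemma shift_unit y : closure (range itinerary) y -> shift e y = y.
Proof.
apply: (continuous_closure_eq cantor_space_hausdorff (@shift_continuousr e)).
  by move=> ?; exact: cvg_id.
by move=> _ [h _ <-]; rewrite shift_itinerary mul1.
Qed.

Lemma shift_mul g h y : closure (range itinerary) y ->
  shift (mul g h) y = shift g (shift h y).
Proof.
move: y; apply: (continuous_closure_eq cantor_space_hausdorff).
- exact: shift_continuousr.
- move=> y; apply: (continuous_comp (@shift_continuousr h y)).
  exact: shift_continuousr.
- by move=> _ [k _ <-]; rewrite !shift_itinerary mulA.
Qed.

Lemma shift_closureE g S y : closure (range itinerary) y ->
  closure (itinerary @` (mul g @` S)) (shift g y) <-> closure (itinerary @` S) y.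
Proof.
move=> Yy; split; last exact: shift_closure.
move=> /(@shift_closure (inv g)); rewrite -shift_mul// mulV shift_unit//.
suff -> : mul (inv g) @` (mul g @` S) = S by [].
apply/seteqP; split => [_ [_ [h Sh <-] <-]|h Sh]; first by rewrite mulK.
by exists (mul g h); rewrite ?mulK//; exists h.
Qed.

(* [shift (d 0)] brings to the coordinate [(0, i)] the value of the indicator
   function of [A i]. *)
Lemma closure_itinerary_separated i S T : S `<=` A i -> T `<=` ~` A i ->
  closure (itinerary @` S) `&` closure (itinerary @` T) = set0.
Proof.
move=> SA TA; apply/seteqP; split => // y [Sy Ty].
pose k := pickle (0%N, i).
have valk h : shift (d 0%N) (itinerary h) k = `[< A i h >].
  by rewrite shift_itinerary /itinerary pickleK mulK.
have val_closure B b : (forall h, B h -> shift (d 0%N) (itinerary h) k = b) ->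
    closure (itinerary @` B) y -> shift (d 0%N) y k = b.
  move=> Bb /(_ _ (@shift_continuousr (d 0%N) y _ (cantor_coord_near _ k))).
  by move=> [_ [[h Bh <-] /= <-]]; exact: Bb.
have yT : shift (d 0%N) y k = true.
  by apply: val_closure Sy => h /SA Ah; rewrite valk; exact/asboolP.
have : shift (d 0%N) y k = false.
  by apply: val_closure Ty => h /TA Ah; rewrite valk; exact/asboolP.
by rewrite yT.
Qed.

Hypothesis cantor_amenable : forall act : G -> cantor_space -> cantor_space,
  continuous_action mul e act ->
  exists mu : probability (borel_type cantor_space) R, invariant_measure act mu.

(** Closure commutes with finite unions, which gives subadditivity; sets separated by some [A i]
    have disjoint closures, which gives additivity across [A i]. *)
Lemma submeasure_separating_seq : exists m : set G -> R,
  invariant_submeasure mul m /\ forall i, additive_across m (A i).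
Proof.
pose Y := closure (range itinerary).
have clY : closed Y by exact: closed_closure.
have [|mu [f [cf Yf muf]]] := invariant_probability_subflow cantor_amenable
  clY _ shift_orbit_closure shift_continuous shift_unit shift_mul.
  by exists (itinerary e); apply: subset_closure; exists e.
pose K S := f @^-1` closure (itinerary @` S).
have mK S : measurable (K S : set (borel_type cantor_space)).
  apply: closed_borel; move/continuous_closedP : cf; apply.
  exact: closed_closure.
have fin S : mu (K S) \is a fin_num by exact: fin_num_measure.
exists (fun S => fine (mu (K S))); split; first split.
- by rewrite /K image_set0 closure0 preimage_set0 measure0.
- have -> : K setT = setT by apply/seteqP; split => // c _; exact: Yf.
  by rewrite probability_setT.
- move=> S T ST; apply: fine_le => //; apply: le_measure; rewrite ?inE//.
  by apply: preimage_subset; apply: closureS; exact: image_subset.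
- move=> S T; rewrite -fineD//; apply: fine_le; rewrite ?fin_numD ?fin//.
  have -> : K (S `|` T) = K S `|` K T.
    by rewrite /K image_setU closureU preimage_setU.
  exact: measureU2.
- move=> g S; congr fine.
  rewrite -(muf g); last exact: closed_closure.
  by congr (mu _); apply/seteqP; split => c /=; rewrite shift_closureE//; exact: Yf.
- move=> i S T SA TA; rewrite -fineD//.
  have -> : K (S `|` T) = K S `|` K T.
    by rewrite /K image_setU closureU preimage_setU.
  rewrite measureU// /K -preimage_setI.
  by rewrite (closure_itinerary_separated SA TA) preimage_set0.
Qed.

End coset_flow.

(** * Limits of submeasures and invariant measures *)

(** Compactness yields a cluster point, and a cluster point of an ultrafilter is a limit. *)
Lemma ultra_cvg_unit_interval (R : realType) (I : Type) (U : set_system I)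
    (f : I -> R) : UltraFilter U -> (forall i, 0 <= f i <= 1) ->
  exists l : R, f @ U --> l.
Proof.
move=> UU f01.
have [|l [_ fl]] := @segment_compact R 0 1 (f @ U) _.
  by apply: nearW => i; rewrite /= in_itv/=.
exists l => N Nl; have [//|nN] := in_ultra_setVsetC (f @^-1` N) UU.
by have [x []] := fl (~` N) N nN Nl.
Qed.

Lemma ler_cvg_near (R : realType) (I : Type) (F : set_system I)
    (f g : I -> R) a b :
  ProperFilter F -> f @ F --> a -> g @ F --> b ->
  (\forall i \near F, f i <= g i) -> a <= b.
Proof.
move=> PF fa gb fg; rewrite -subr_ge0.
apply: (@closed_cvg _ _ F PF (g \- f) (fun x => 0 <= x)).
- exact: closed_ge.
- by apply: filterS fg => i; rewrite /= subr_ge0.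
- exact: cvgB.
Qed.

(** These are the unions of right cosets [V g] of some open subgroup [V]. *)
Definition left_uniform_set (G : topologicalType) (mul : G -> G -> G)
    (inv : G -> G) (e : G) (A : set G) : Prop :=
  exists V : set G, [/\ open V, is_subgroup mul inv e V &
    forall v g, V v -> A g -> A (mul v g)].

Lemma is_subgroupI (G : Type) (mul : G -> G -> G) (inv : G -> G) (e : G)
    (V W : set G) : is_subgroup mul inv e V -> is_subgroup mul inv e W ->
  is_subgroup mul inv e (V `&` W).
Proof.
move=> [V1 VM VV] [W1 WM WV]; split => //.
  by move=> x y [Vx Wx] [Vy Wy]; split; [exact: VM | exact: WM].
by move=> x [Vx Wx]; split; [exact: VV | exact: WV].
Qed.

Section separating_submeasure.
Context (R : realType) (G : topologicalType).
Context (mul : G -> G -> G) (inv : G -> G) (e : G).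
Hypothesis topG : topological_group mul inv e.
Hypothesis separableG : exists D : set G, countable D /\ closure D = [set: G].
Hypothesis cantor_amenable : forall act : G -> cantor_space -> cantor_space,
  continuous_action mul e act ->
  exists mu : probability (borel_type cantor_space) R, invariant_measure act mu.

Local Notation left_uniform := (left_uniform_set mul inv e).

Lemma dense_sequence :
  exists d : nat -> G, forall U, open U -> U !=set0 -> exists n, U (d n).
Proof.
have [D [cD clD]] := separableG.
have meetD U : open U -> U !=set0 -> D `&` U !=set0.
  move=> oU [x Ux]; have : closure D x by rewrite clD.
  by apply; exact: open_nbhs_nbhs.
have /countable_injP[f f_inj] := cD.
(* Numbers that code no point of [D] are sent to [e], which does no harm to density. *)
pose d n := xget e [set x | D x /\ f x = n].
exists d => U oU /(meetD _ oU)[x [Dx Ux]]; exists (f x).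
have [Dd fd] : D (d (f x)) /\ f (d (f x)) = f x.
  by apply: (@xgetPex _ _ [set y | D y /\ f y = f x]); exists x.
by rewrite (f_inj _ _ _ _ fd)// inE.
Qed.

(** Open subgroups are stable under finite intersections only, hence the detour through finite
    lists. Entries that are not left uniform are skipped. *)
Lemma common_subgroup (F : seq (set G)) : exists V : set G,
  [/\ open V, is_subgroup mul inv e V & forall A, A \in F -> left_uniform A ->
    forall v g, V v -> A g -> A (mul v g)].
Proof.
elim: F => [|A F [V [oV sV VF]]].
  by exists setT; split => //; exact: openT.
have [[W [oW sW WA]]|nA] := pselect (left_uniform A).
  exists (V `&` W); split; [exact: openI|exact: is_subgroupI|].
  move=> B; rewrite inE => /orP[/eqP ->|BF] uB v g [Vv Wv]; first exact: WA.
  exact: VF.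
by exists V; split => // B; rewrite inE => /orP[/eqP ->//|]; exact: VF.
Qed.

Lemma submeasure_separating_finite (F : seq (set G)) : exists m : set G -> R,
  invariant_submeasure mul m /\
  forall A, A \in F -> left_uniform A -> additive_across m A.
Proof.
have [d dP] := dense_sequence; have [V [oV sV VF]] := common_subgroup F.
(* Unsuitable entries, and indices beyond the list, give the empty set, which every subgroup
   fixes. *)
pose A i := if pselect (left_uniform (nth set0 F i)) then nth set0 F i else set0.
have AV i v g : V v -> A i g -> A i (mul v g).
  rewrite /A; case: pselect => // uA; have [iF|iF] := ltnP i (size F).
    exact: (VF _ (mem_nth _ iF) uA).
  by move=> /= _; rewrite nth_default.
have [m [mI mA]] := submeasure_separating_seq topG dP oV sV AV cantor_amenable.
exists m; split => // B BF uB; have := mA (index B F).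
by rewrite /A nth_index//; case: pselect.
Qed.

Lemma exists_separating_submeasure : exists m : set G -> R,
  invariant_submeasure mul m /\ forall A, left_uniform A -> additive_across m A.
Proof.
have [mF mFP] := choice submeasure_separating_finite.
have mFI F : invariant_submeasure mul (mF F) by case: (mFP F).
(* Finite lists directed by inclusion; concatenation provides upper bounds. All the required
   relations are equalities or weak inequalities, so they survive the limit. *)
pose fin := filter_from [set: seq (set G)]
  (fun E => [set F : seq (set G) | {subset E <= F}]).
have PF : ProperFilter fin.
  apply: filter_from_proper; last by move=> E _; exists E => /=.
  apply: filter_from_filter; first by exists [::].
  move=> E F _ _; exists (E ++ F) => // H /= EFH; split => A AE;
    by apply: EFH; rewrite mem_cat AE ?orbT.
have [U [UU finU]] := ultraFilterLemma PF.
have PU : ProperFilter U by exact: ultra_proper.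
have ex_lim S : exists l : R, (fun F => mF F S) @ U --> l.
  apply: ultra_cvg_unit_interval => F.
  rewrite -(submeasure0 (mFI F)) -(submeasureT (mFI F)).
  by apply/andP; split; apply: le_submeasure (mFI F) _ _ _.
have [m mP] := choice ex_lim.
have m_cst S c : (forall F, mF F S = c) -> m S = c.
  move=> mS; have := mP S; rewrite (_ : (fun F => mF F S) = cst c).
    by move=> mc; apply: (cvg_unique _ mc); [exact: Rhausdorff | exact: cvg_cst].
  by apply/funext => F; rewrite mS.
exists m; split; first split.
- by apply: m_cst => F; rewrite (submeasure0 (mFI F)).
- by apply: m_cst => F; rewrite (submeasureT (mFI F)).
- move=> S T ST; apply: ler_cvg_near (mP S) (mP T) _.
  by apply: nearW => F; exact: (le_submeasure (mFI F)).
- move=> S T; apply: ler_cvg_near (mP _) (cvgD (mP S) (mP T)) _.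
  by apply: nearW => F; exact: (submeasureU (mFI F)).
- move=> g S; have := mP (mul g @` S).
  rewrite (_ : (fun F => mF F (mul g @` S)) = (fun F => mF F S)).
    by move=> mS; apply: (cvg_unique _ mS (mP S)); exact: Rhausdorff.
  by apply/funext => F; rewrite (submeasure_invariant (mFI F)).
- move=> A uA S T SA TA; apply: ler_cvg_near (cvgD (mP S) (mP T)) (mP _) _.
  (* Additivity across [A] holds for every list containing [A], hence along the ultrafilter. *)
  apply: finU; exists [:: A] => // F /= AF.
  by have [_ /(_ A)] := mFP F; apply => //; apply: AF; rewrite inE.
Qed.

End separating_submeasure.

(** As [e] fixes each point of [C], joint continuity and compactness of [C] show that the [v] moving
    [C] off [D] form a neighbourhood of [e]; it contains an open subgroup. *)
Lemma closed_disjoint_separation (G : topologicalType) (X : topologicalType)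
    (mul : G -> G -> G) (inv : G -> G) (e : G) (act : G -> X -> X) (C D : set X) :
  non_archimedean mul inv e -> compact [set: X] -> continuous_action mul e act ->
  closed C -> closed D -> C `&` D = set0 ->
  exists V : set G, [/\ open V, is_subgroup mul inv e V &
    forall v x, V v -> C x -> ~ D (act v x)].
Proof.
move=> [_ nonarch] cptX [act1 actM cact] clC clD CD.
have /compact_near_coveringP cvC : compact C.
  by apply: (subclosed_compact clC cptX).
have [|V [oV sV VP]] := nonarch [set v | C `<=` (fun x => ~ D (act v x))].
  apply: (cvC G (nbhs e) (fun v x => ~ D (act v x))) => x Cx.
  have nDx : nbhs (act (e, x).1 (e, x).2) (~` D).
    rewrite /= act1; apply: open_nbhs_nbhs; split; first exact: closed_openC.
    by move=> Dx; have : (C `&` D) x by []; rewrite CD.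
  have [[P Q] /= [eP xQ] PQ] := cact (e, x) _ nDx.
  by exists (Q, P) => //= -[y v] [Qy Pv]; exact: (PQ (v, y)).
by exists V; split => // v x /VP; exact.
Qed.

Theorem theorem2p2p15 (R : realType) (G : topologicalType)
    (mul : G -> G -> G) (inv : G -> G) (e : G) :
  topological_group mul inv e ->
  polish_space R G ->
  non_archimedean mul inv e ->
  (amenable R mul e <->
   forall act : G -> cantor_space -> cantor_space,
     continuous_action mul e act ->
     exists mu : probability (borel_type cantor_space) R, invariant_measure act mu).
Proof.
move=> topG [separableG _] nonarch; split.
  move=> amenG act ca.
  have [mu [muI _]] := amenG cantor_space act cantor_space_compact
    cantor_space_hausdorff ca.
  by exists mu.
move=> cantor_amenable X act cptX hsdfX ca.
have [m [mI mU]] := exists_separating_submeasure topG separableG cantor_amenable.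
have [act1 actM cact] := ca.
have [mulA mul1 mulV _ _] := topG.
have actK g x : act (inv g) (act g x) = x.
  by rewrite -actM (mulV g).1 act1.
have actVK g x : act g (act (inv g) x) = x.
  by rewrite -actM (mulV g).2 act1.
pose orbit (S : set X) : set G := [set g | S (act g point)].
have [|||S T|C D clC clD CD|mu [muR muI]] :=
  @regular_probability_of_content R X (m \o orbit) cptX hsdfX.
- exact: (submeasure0 mI).
- exact: (submeasureT mI).
- by move=> S T ST; apply: (le_submeasure mI) => g; exact: ST.
- exact: (submeasureU mI).
- have [V [oV [V1 VM VV] VCD]] :=
    closed_disjoint_separation nonarch cptX ca clC clD CD.
  (* This is [V^-1] times [orbit C]: it is fixed by [V], contains [orbit C], and misses [orbit D] by
     the choice of [V]. *)
  pose A : set G := [set g | exists2 v, V v & C (act v (act g point))].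
  apply: (mU A).
  + exists V; split => // v g Vv [w Vw Cw]; exists (mul w (inv v)).
      by apply: VM => //; exact: VV.
    by rewrite (actM w) (actM v) actK.
  + by move=> g Cg; exists e => //; rewrite act1.
  + move=> g Dg [v Vv Cv]; apply: (VCD (inv v) _ (VV _ Vv) Cv).
    by rewrite actK.
exists mu; split => // g A _; apply: (muI (act g) (act (inv g))).
- exact: continuous_pairl cact.
- exact: continuous_pairl cact.
- by move=> x; rewrite actK.
- by move=> x; rewrite actVK.
(* The orbit map is equivariant: pulling [C] back by [act g] translates [orbit C] by [inv g]. *)
- move=> C clC; rewrite /= -(submeasure_invariant mI (inv g) (orbit C)).
  congr m; apply/seteqP; split => h /=.
    rewrite /orbit/= -actM => Ch; exists (mul g h) => //.
    by rewrite mulA (mulV g).1 (mul1 h).1.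
  move=> [k Ck <-]; rewrite /orbit/= -actM mulA (mulV g).2 (mul1 k).1.
  exact: Ck.
Qed.
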